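(* Let $\mathcal A:\mathbb R^{n_1\times n_2}\to\mathbb R^m$ be linear, $r\ge1$ an integer, and $\alpha>0$, $c>0$ fixed; let $q=\min\{n_1,n_2\}$. The following are equivalent: (i) every matrix $\mathbf X^0$ of rank at most $r$ with $\|\mathbf X^0\|_2=c$ is the unique minimizer of problem (N2) with $\mathbf b=\mathcal A(\mathbf X^0)$; (ii) every $\mathbf H\in\mathrm{Null}(\mathcal A)$ satisfies $$\Big(1+\frac{c}{\alpha}\Big)\sum_{i=1}^r\sigma_i(\mathbf H)\le\sum_{i=r+1}^{q}\sigma_i(\mathbf H).$$
   Context: Problem (N2) is $\min_{\mathbf X}\{\|\mathbf X\|_*+\frac{1}{2\alpha}\|\mathbf X\|_F^2:\ \mathcal A(\mathbf X)=\mathbf b\}$, where $\mathcal A(\mathbf X)_i=\mathrm{trace}(\mathbf A_i^\top\mathbf X)$ for given matrices $\mathbf A_i$. $\sigma_i(\mathbf X)$ is the $i$-th largest singular value; $\|\mathbf X\|_*=\sum_i\sigma_i(\mathbf X)$, $\|\mathbf X\|_F$ the Frobenius norm, $\|\mathbf X\|_2=\sigma_1(\mathbf X)$. *)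

(* Defs.v *)
From HB Require Import structures.
From mathcomp Require Import all_boot all_order all_algebra.
From Stdlib Require Import ClassicalEpsilon.
Set Implicit Arguments. Unset Strict Implicit. Unset Printing Implicit Defensive.
Import Order.TTheory GRing.Theory Num.Theory.
Local Open Scope ring_scope.

Section SV.
Variable R : rcfType.

(* s is the nonincreasing list (indexed 0..q-1, q = min n1 n2) of the singular
   values of X: nonnegative, and the eigenvalues of X^T X (with multiplicity) are
   s_0^2,...,s_{q-1}^2 together with n2-q zeros. *)
Definition is_sing_vals (n1 n2 : nat) (X : 'M[R]_(n1, n2))
    (s : 'I_(minn n1 n2) -> R) : Prop :=
  (forall i, 0 <= s i) /\
  (forall i j : 'I_(minn n1 n2), (i <= j)%N -> s j <= s i) /\
  char_poly (X^T *m X) =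
    'X^(n2 - minn n1 n2) * \prod_(i < minn n1 n2) ('X - (s i ^+ 2)%:P).

Definition sing_vals (n1 n2 : nat) (X : 'M[R]_(n1, n2)) : 'I_(minn n1 n2) -> R :=
  epsilon (inhabits (fun _ => 0)) (is_sing_vals X).

(* sigma X i = sigma_{i+1}(X) (0-based), and 0 for i >= min n1 n2 *)
Definition sigma (n1 n2 : nat) (X : 'M[R]_(n1, n2)) (i : nat) : R :=
  match ltnP i (minn n1 n2) with
  | LtnNotGeq Hi => sing_vals X (Ordinal Hi)
  | _ => 0
  end.

Definition nucnorm (n1 n2 : nat) (X : 'M[R]_(n1, n2)) : R :=
  \sum_(i < minn n1 n2) sigma X i.

Definition specnorm (n1 n2 : nat) (X : 'M[R]_(n1, n2)) : R := sigma X 0.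

Definition frob2 (n1 n2 : nat) (X : 'M[R]_(n1, n2)) : R :=
  \sum_(i < n1) \sum_(j < n2) X i j ^+ 2.

Definition opA (m n1 n2 : nat) (A : 'I_m -> 'M[R]_(n1, n2)) (X : 'M[R]_(n1, n2))
  : 'cV[R]_m := \col_i \tr ((A i)^T *m X).

Definition objN2 (alpha : R) (n1 n2 : nat) (X : 'M[R]_(n1, n2)) : R :=
  nucnorm X + frob2 X / (2 * alpha).

Definition unique_minimizer_N2 (m n1 n2 : nat) (A : 'I_m -> 'M[R]_(n1, n2))
  (alpha : R) (b : 'cV[R]_m) (X0 : 'M[R]_(n1, n2)) : Prop :=
  opA A X0 = b /\
  forall X : 'M[R]_(n1, n2), opA A X = b -> X <> X0 -> objN2 alpha X0 < objN2 alpha X.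

End SV.

(* Main.v *)
Require Import Defs.
From HB Require Import structures.
From mathcomp Require Import all_boot all_order all_algebra all_fingroup.
From mathcomp Require Import complex ring lra zify.
From Stdlib Require Import ClassicalEpsilon.
Set Implicit Arguments. Unset Strict Implicit. Unset Printing Implicit Defensive.
Import Order.TTheory GRing.Theory Num.Theory.
Local Open Scope ring_scope.

(** Both directions rest on the singular value decomposition over a real closed field.

    Sufficiency: for H in the null space, Mirsky's inequality
    sum_i |sigma_i(X0) - sigma_i(H)| <= ||X0 - H||_* bounds the nuclear norm from below, while
    <X0, H> <= c sum_(i < r) sigma_i(H) bounds the cross term of the Frobenius norm; the remaining
    ||H||_F^2 / (2 alpha) gives strictness.  Mirsky's inequality follows from Weyl monotonicity:
    with dil X = [[0, X], [X^T, 0]], of spectrum {sigma_i, - sigma_i, 0}, the matrix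
    C = dil Y + (dil (X - Y))_+ dominates dil X and dil Y, so its eigenvalues dominate both
    spectra, and its trace is ||X - Y||_*.

    Necessity: if H = P diag(sigma) Q^T violates the inequality, then moving from
    X0 = - c P diag(1_(i < r)) Q^T along t H with t small lowers the objective. *)

(** * Frobenius inner product, real eigenvectors of symmetric matrices, Householder reflections *)

Section Dot.
Variable R : rcfType.

Definition dot (m n : nat) (X Y : 'M[R]_(m, n)) : R := \tr (X *m Y^T).

Lemma dotE m n (X Y : 'M[R]_(m, n)) : dot X Y = \sum_i \sum_j X i j * Y i j.
Proof. by apply: eq_bigr => i _; rewrite mxE; apply: eq_bigr => j _; rewrite mxE. Qed.

Lemma dotC m n (X Y : 'M[R]_(m, n)) : dot X Y = dot Y X.
Proof. by rewrite /dot -mxtrace_tr trmx_mul trmxK. Qed.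

Lemma dotDl m n (X Y Z : 'M[R]_(m, n)) : dot (X + Y) Z = dot X Z + dot Y Z.
Proof. by rewrite /dot mulmxDl mxtraceD. Qed.

Lemma dotDr m n (X Y Z : 'M[R]_(m, n)) : dot Z (X + Y) = dot Z X + dot Z Y.
Proof. by rewrite dotC dotDl ![dot _ Z]dotC. Qed.

Lemma dotZl m n a (X Y : 'M[R]_(m, n)) : dot (a *: X) Y = a * dot X Y.
Proof. by rewrite /dot -scalemxAl mxtraceZ. Qed.

Lemma dotZr m n a (X Y : 'M[R]_(m, n)) : dot X (a *: Y) = a * dot X Y.
Proof. by rewrite dotC dotZl dotC. Qed.

Lemma dotNl m n (X Y : 'M[R]_(m, n)) : dot (- X) Y = - dot X Y.
Proof. by rewrite -scaleN1r dotZl mulN1r. Qed.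

Lemma dotNr m n (X Y : 'M[R]_(m, n)) : dot X (- Y) = - dot X Y.
Proof. by rewrite dotC dotNl dotC. Qed.

Lemma dot_mulr m n p (X : 'M[R]_(m, n)) (A : 'M_(n, p)) Y :
  dot (X *m A) Y = dot X (Y *m A^T).
Proof. by rewrite /dot trmx_mul trmxK mulmxA. Qed.

Lemma dot_mull m n p (X : 'M[R]_(m, n)) (A : 'M_(p, m)) Y :
  dot (A *m X) Y = dot X (A^T *m Y).
Proof. by rewrite /dot trmx_mul trmxK -mulmxA mxtrace_mulC mulmxA. Qed.

Lemma dot_ge0 m n (X : 'M[R]_(m, n)) : 0 <= dot X X.
Proof.
by rewrite dotE; apply: sumr_ge0 => i _; apply: sumr_ge0 => j _; rewrite -expr2 sqr_ge0.
Qed.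

Lemma dot_eq0 m n (X : 'M[R]_(m, n)) : (dot X X == 0) = (X == 0).
Proof.
apply/eqP/eqP => [|->]; last by rewrite /dot mul0mx mxtrace0.
rewrite dotE => X0; apply/matrixP => i j; rewrite mxE.
have sq_ge0 k l : 0 <= X k l * X k l by rewrite -expr2 sqr_ge0.
have := psumr_eq0P (fun k _ => sumr_ge0 _ (fun l _ => sq_ge0 k l)) X0 (i := i) isT.
move=> /(psumr_eq0P (fun l _ => sq_ge0 i l)) /(_ j isT) /eqP.
by rewrite mulf_eq0 orbb => /eqP.
Qed.

Lemma dot_gt0 m n (X : 'M[R]_(m, n)) : (0 < dot X X) = (X != 0).
Proof. by rewrite lt0r dot_ge0 andbT dot_eq0. Qed.

Lemma dot_row_mx m n p (X Z : 'M[R]_(m, n)) (Y W : 'M_(m, p)) :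
  dot (row_mx X Y) (row_mx Z W) = dot X Z + dot Y W.
Proof. by rewrite /dot tr_row_mx mul_row_col mxtraceD. Qed.

Lemma normalize_vec n (v : 'rV[R]_n) : v != 0 ->
  exists2 a : R, a != 0 & dot (a *: v) (a *: v) = 1.
Proof.
rewrite -dot_gt0 => v_gt0; exists (Num.sqrt (dot v v))^-1.
  by rewrite invr_eq0 gt_eqF ?sqrtr_gt0.
by rewrite dotZl dotZr mulrA -invfM -expr2 sqr_sqrtr ?ltW // mulVf ?gt_eqF.
Qed.

(* A complex eigenvector x + iy of a + ib satisfies b (|x|^2 + |y|^2) = 0 by symmetry. *)
Lemma sym_eigen n (S : 'M[R]_n.+1) : S^T = S ->
  exists a : R, exists2 v : 'rV_n.+1, dot v v = 1 & v *m S = a *: v.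
Proof.
move=> symS.
have [z] : exists z : R[i], root (char_poly (map_mx (real_complex R) S)) z.
  by apply/closed_rootP; rewrite size_char_poly.
rewrite -eigenvalue_root_char => /eigenvalueP[w wS w_neq0].
pose x := map_mx (@complex.Re R) w; pose y := map_mx (@complex.Im R) w.
case: z wS => a b wS.
have sumRe I (r : seq I) (F : I -> R[i]) :
    complex.Re (\sum_(i <- r) F i) = \sum_(i <- r) complex.Re (F i).
  by apply: (big_morph (@complex.Re R)) => // [[? ?] [? ?]].
have sumIm I (r : seq I) (F : I -> R[i]) :
    complex.Im (\sum_(i <- r) F i) = \sum_(i <- r) complex.Im (F i).
  by apply: (big_morph (@complex.Im R)) => // [[? ?] [? ?]].
have xS : x *m S = a *: x - b *: y.
  apply/rowP => j; move/rowP: wS => /(_ j) /(congr1 (@complex.Re R)).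
  rewrite !mxE sumRe; case: (w 0 j) => c d /= <-.
  by apply: eq_bigr => k _; rewrite !mxE; case: (w 0 k) => e f /=; rewrite mulr0 subr0.
have yS : y *m S = b *: x + a *: y.
  apply/rowP => j; move/rowP: wS => /(_ j) /(congr1 (@complex.Im R)).
  rewrite !mxE sumIm; case: (w 0 j) => c d /=; rewrite addrC => <-.
  by apply: eq_bigr => k _; rewrite !mxE; case: (w 0 k) => e f /=; rewrite mulr0 add0r.
have xy_neq0 : (x != 0) || (y != 0).
  rewrite -negb_and; apply: contra w_neq0 => /andP[/eqP x0 /eqP y0].
  apply/eqP/rowP => j; move/rowP: x0 => /(_ j); move/rowP: y0 => /(_ j).
  by rewrite !mxE; case: (w 0 j) => c d /= -> ->.
have b0 : b = 0.
  have := dot_mulr x S y; rewrite symS xS yS dotDl dotDr dotNl !(dotZl, dotZr).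
  have := dotC x y; have := dot_ge0 x; have := dot_ge0 y => dy dx _ h.
  have : b * (dot x x + dot y y) = 0 by lra.
  move/eqP; rewrite mulf_eq0 => /orP[/eqP //|].
  by rewrite paddr_eq0 // !dot_eq0 -[_ && _]negbK negb_and xy_neq0.
(* With b = 0 both the real part x and the imaginary part y satisfy the eigenvector equation for a,
   and at least one of them is nonzero. *)
exists a; rewrite b0 !scale0r ?subr0 ?add0r in xS yS.
have [v v_neq0 vS] : exists2 v : 'rV_n.+1, v != 0 & v *m S = a *: v.
  by case/orP: xy_neq0 => ?; [exists x | exists y].
have [k k_neq0 kv] := normalize_vec v_neq0.
by exists (k *: v); rewrite // -scalemxAl vS !scalerA mulrC.
Qed.

(** The reflection along w = v - e exchanges the unit vectors v and e; it exists as soon as v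
    differs from e, and otherwise the identity serves. *)
Lemma householder n (v : 'rV[R]_n.+1) : dot v v = 1 ->
  exists2 Q : 'M_n.+1, Q^T *m Q = 1%:M & v *m Q = delta_mx 0 0.
Proof.
move=> v1; pose e : 'rV[R]_n.+1 := delta_mx 0 0.
have [w wE] : exists w, w = v - e by exists (v - e).
have e1 : dot e e = 1 by rewrite /dot trmx_delta mul_delta_mx trace_mx11 mxE.
have [w0|w_neq0] := eqVneq w 0.
  exists 1%:M; first by rewrite mulmx1 trmx1.
  by rewrite mulmx1; apply/eqP; rewrite -subr_eq0 -/e -wE w0.
have rr (x y : 'rV[R]_n.+1) : x *m y^T = (dot x y)%:M by rewrite [LHS]mx11_scalar -trace_mx11.
have ww : dot w w = 2 - 2 * dot v e.
  by rewrite wE dotDl !dotDr !dotNl !dotNr (dotC e v) v1 e1; ring.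
have vw : dot v w = 1 - dot v e by rewrite wE dotDr dotNr v1.
have ww_neq0 : dot w w != 0 by rewrite dot_eq0.
pose k := 2 / dot w w; pose Q : 'M[R]_n.+1 := 1%:M - k *: (w^T *m w).
have QT : Q^T = Q.
  by rewrite /Q linearB /= linearZ /= trmx_mul trmxK trmx1.
exists Q.
  rewrite QT /Q mulmxBl mul1mx !mulmxBr mulmx1 -!scalemxAl -!scalemxAr.
  rewrite mulmxA -(mulmxA w^T w) rr mul_mx_scalar -scalemxAl !scalerA.
  have -> : k * (k * dot w w) = k + k by rewrite /k; field.
  by rewrite scalerDl opprB [_ + _ - _]addrK subrK.
rewrite /Q mulmxBr mulmx1 -scalemxAr mulmxA rr mul_scalar_mx scalerA.
(* Since v and e are both unit vectors, <w, w> = 2 <v, w>, so the reflection subtracts exactly w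
   from v. *)
have -> : k * dot v w = 1.
  have -> : dot v w = dot w w / 2 by rewrite vw ww; field.
  by rewrite /k; field.
by rewrite scale1r wE opprB addrC subrK.
Qed.

End Dot.

(** * Spectral theorem and singular value decomposition *)

Section Spectral.
Variable R : rcfType.

Lemma tr_block_diag_mul m n q (B : 'M[R]_(m, n)) :
  B^T *m B = 1%:M ->
  (block_mx (1%:M : 'M_q) 0 0 B)^T *m block_mx 1%:M 0 0 B = 1%:M.
Proof.
move=> BB; rewrite tr_block_mx mulmx_block !trmx0 !trmx1 !mul0mx !mulmx0 !addr0 !add0r.
by rewrite BB mulmx1 -scalar_mx_block.
Qed.

Lemma block_diag_factor k m n (P : 'M[R]_(m, k)) (Q : 'M[R]_(n, k)) (d : 'rV_k) (a : R) :
  block_mx (a%:M : 'M_1) 0 0 (P *m diag_mx d *m Q^T) =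
  block_mx 1%:M 0 0 P *m diag_mx (row_mx a%:M d) *m (block_mx 1%:M 0 0 Q)^T.
Proof.
rewrite diag_mx_row tr_block_mx !mulmx_block !trmx0 !trmx1.
rewrite !(mul0mx, mulmx0, addr0, add0r, mul1mx, mulmx1).
by congr block_mx; apply/matrixP => i j; rewrite !mxE !ord1.
Qed.

(** The deflation step shared by the spectral theorem and the singular value decomposition: the two
    equations fix the first row and the first column of Y, leaving a smaller block for the
    induction. *)
Lemma block_of_delta m n (Y : 'M[R]_(1 + m, 1 + n)) (a : R) :
  delta_mx 0 0 *m Y = a *: (delta_mx 0 0 : 'rV_(1 + n)) ->
  delta_mx 0 0 *m Y^T = a *: (delta_mx 0 0 : 'rV_(1 + m)) ->
  Y = block_mx a%:M 0 0 (drsubmx Y).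
Proof.
rewrite -!rowE => r0 c0.
have Y0 j : Y 0 j = a *+ (j == 0).
  by have /rowP/(_ j) := r0; rewrite !mxE => ->; rewrite eqxx /= ?mul1r ?mulr_natr.
have Y1 i : Y i 0 = a *+ (i == 0).
  by have /rowP/(_ i) := c0; rewrite !mxE => ->; rewrite eqxx /= ?mul1r ?mulr_natr.
have l0 k : lshift k (0 : 'I_1) = 0 :> 'I_(1 + k) by exact/val_inj.
rewrite -[LHS]submxK; congr block_mx; apply/matrixP => i j; rewrite !mxE ?ord1 ?l0.
- by rewrite Y0 !eqxx.
- by rewrite Y0.
- by rewrite Y1.
Qed.

(** Induction by deflation: a Householder reflection moves a unit eigenvector to the first basis
    vector, and the remaining diagonal block is again symmetric. *)
Lemma spectral_thm n (S : 'M[R]_n) : S^T = S ->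
  exists P : 'M_n, exists2 d : 'rV_n, P^T *m P = 1%:M & S = P *m diag_mx d *m P^T.
Proof.
elim: n S => [|n IHn] S symS.
  by exists 1%:M, 0; rewrite ?trmx1 ?mulmx1 //; apply/matrixP => [[]].
have [a [v v1 vS]] := sym_eigen symS.
have [Q QQ vQ] := householder v1.
have QQ' : Q *m Q^T = 1%:M by apply: mulmx1C.
pose Y : 'M_(1 + n) := Q^T *m S *m Q.
have symY : Y^T = Y by rewrite /Y !trmx_mul symS trmxK mulmxA.
have e0Y : delta_mx 0 0 *m Y = a *: (delta_mx 0 0 : 'rV_(1 + n)).
  by rewrite -vQ /Y !mulmxA -(mulmxA v) QQ' mulmx1 vS -scalemxAl.
have Yb : Y = block_mx a%:M 0 0 (drsubmx Y) by apply: block_of_delta; rewrite ?symY.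
have symZ : (drsubmx Y)^T = drsubmx Y by rewrite trmx_drsub symY.
have [P [d PP Zd]] := IHn _ symZ.
exists (Q *m block_mx (1%:M : 'M_1) 0 0 P), (row_mx a%:M d).
  rewrite trmx_mul -mulmxA (mulmxA Q^T) QQ mul1mx.
  exact: (@tr_block_diag_mul _ _ 1).
have -> : S = Q *m Y *m Q^T by rewrite /Y !mulmxA QQ' mul1mx -mulmxA QQ' mulmx1.
by rewrite [in LHS]Yb Zd block_diag_factor trmx_mul !mulmxA.
Qed.

(** Deflation by one singular pair (u, v) at a time. The value split off need not be the largest, so
    sorting is postponed; [q] is a variable so that the induction can run on it. *)
Lemma svd_unsorted q n1 n2 (X : 'M[R]_(n1, n2)) : q = minn n1 n2 ->
  exists (P : 'M_(n1, q)) (Q : 'M_(n2, q)) (d : 'rV_q),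
  [/\ P^T *m P = 1%:M, Q^T *m Q = 1%:M, forall i, 0 <= d 0 i
    & X = P *m diag_mx d *m Q^T].
Proof.
elim: q n1 n2 X => [|q IHq] n1 n2 X qE.
  exists 0, 0, 0; split=> [| | [] //|]; try by apply/matrixP => [[]].
  have : (n1 == 0) || (n2 == 0) by move: qE; case: ltnP => _ <-; rewrite eqxx ?orbT.
  case/orP=> /eqP n0; subst n1 || subst n2; first by rewrite [X]flatmx0 [RHS]flatmx0.
  by rewrite [X]thinmx0 [RHS]thinmx0.
case: n1 n2 X qE => [|n1] [|n2] X //; rewrite minnSS => -[qE].
have [X0|X_neq0] := eqVneq X 0.
  exists (pid_mx q.+1), (pid_mx q.+1), 0.
  have pidK n : (q <= n)%N ->
      (pid_mx q.+1 : 'M[R]_(n.+1, q.+1))^T *m pid_mx q.+1 = 1%:M.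
    by move=> qn; rewrite tr_pid_mx mul_pid_mx minnn (minn_idPr _) ?pid_mx_1.
  split=> [| |i|]; rewrite ?pidK ?qE ?geq_minl ?geq_minr ?mxE //.
  by rewrite X0 linear0 mulmx0 mul0mx.
have symG : (X^T *m X)^T = X^T *m X by rewrite trmx_mul trmxK.
have [a [v [u [a_gt0 [v1 u1] [uX vX]]]]] : exists (a : R) (v : 'rV_n2.+1) (u : 'rV_n1.+1),
    [/\ 0 < a, dot v v = 1 /\ dot u u = 1 & u *m X = a *: v /\ v *m X^T = a *: u].
  have [P [d PP Gd]] := spectral_thm symG.
  (* If all eigenvalues of X^T X vanished, its trace ||X||_F^2 would vanish too. A nonzero
     eigenvalue then yields a as its square root, v as its eigenvector and u = v X^T / a. *)
  have [i di_neq0] : exists i, d 0 i != 0.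
    apply/existsP; apply: contraNT X_neq0 => /existsPn d0.
    have d00 : d = 0 by apply/rowP => i; rewrite mxE; apply/eqP; rewrite -[_ == _]negbK d0.
    by rewrite -dot_eq0 /dot mxtrace_mulC Gd d00 linear0 mulmx0 mul0mx mxtrace0.
  pose v := row i P^T.
  have v1 : dot v v = 1.
    have /matrixP/(_ i i) := PP; rewrite !mxE eqxx dotE big_ord1 [true%:R]mulr1n => <-.
    by apply: eq_bigr => j _; rewrite !mxE.
  have vG : v *m (X^T *m X) = d 0 i *: v.
    by rewrite Gd !mulmxA /v -row_mul PP row1 -rowE row_diag_mx -scalemxAl -rowE.
  have vXX : dot (v *m X^T) (v *m X^T) = d 0 i.
    by rewrite dot_mulr trmxK -mulmxA vG dotZr v1 mulr1.
  have d_gt0 : 0 < d 0 i by rewrite lt0r di_neq0 -vXX dot_ge0.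
  pose a := Num.sqrt (d 0 i); have a_gt0 : 0 < a by rewrite sqrtr_gt0.
  have aa : a ^+ 2 = d 0 i by rewrite sqr_sqrtr ?ltW.
  exists a, v, (a^-1 *: (v *m X^T)); split=> //; split=> //.
  - by rewrite dotZl dotZr vXX -aa; field; rewrite gt_eqF.
  - rewrite -scalemxAl -mulmxA vG scalerA -aa; congr (_ *: _); field; by rewrite gt_eqF.
  - by rewrite scalerA mulfV ?scale1r ?gt_eqF.
have [U UU uU] := householder u1; have [V VV vV] := householder v1.
have UU' : U *m U^T = 1%:M by apply: mulmx1C.
have VV' : V *m V^T = 1%:M by apply: mulmx1C.
pose Y : 'M_(1 + n1, 1 + n2) := U^T *m X *m V.
have Yb : Y = block_mx a%:M 0 0 (drsubmx Y).
  apply: block_of_delta.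
    by rewrite -uU /Y !mulmxA -(mulmxA u) UU' mulmx1 uX -scalemxAl vV.
  by rewrite -vV /Y !trmx_mul trmxK !mulmxA -(mulmxA v) VV' mulmx1 vX -scalemxAl uU.
have [P [Q [d [PP QQ d_ge0 Zd]]]] := IHq _ _ (drsubmx Y) qE.
exists (U *m block_mx (1%:M : 'M_1) 0 0 P), (V *m block_mx (1%:M : 'M_1) 0 0 Q), (row_mx a%:M d).
split.
- rewrite trmx_mul -mulmxA (mulmxA U^T) UU mul1mx; exact: (@tr_block_diag_mul _ _ 1).
- rewrite trmx_mul -mulmxA (mulmxA V^T) VV mul1mx; exact: (@tr_block_diag_mul _ _ 1).
- move=> i; rewrite mxE; case: splitP => j _ //; by rewrite mxE ord1 ltW.
have -> : X = U *m Y *m V^T by rewrite /Y !mulmxA UU' mul1mx -mulmxA VV' mulmx1.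
by rewrite [in LHS]Yb Zd block_diag_factor trmx_mul !mulmxA.
Qed.

End Spectral.

(** * Existence and uniqueness of the sorted singular values *)

Section SingularValues.
Variable R : rcfType.

Lemma mul_diag_trE m n q (P : 'M[R]_(m, q)) (Q : 'M[R]_(n, q)) (d : 'rV_q) i j :
  (P *m diag_mx d *m Q^T) i j = \sum_k d 0 k * P i k * Q j k.
Proof.
rewrite mul_mx_diag mxE; apply: eq_bigr => k _.
by rewrite !mxE [P _ _ * _]mulrC.
Qed.

Lemma exists_sorting_perm n (d : 'rV[R]_n) :
  exists s : 'S_n, forall i j : 'I_n, (i <= j)%N -> d 0 (s j) <= d 0 (s i).
Proof.
pose t : n.-tuple R := [tuple d 0 i | i < n].
have /tuple_permP[s sE] : perm_eq (sort >=%R t) t by rewrite perm_sort.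
exists s => i j ij.
have srt : sorted >=%R (sort >=%R t).
  by apply: sort_sorted => x y /=; rewrite orbC le_total.
have ge_trans : transitive (>=%R : rel R) by move=> y x z /= yx zy; apply: le_trans yx.
have ntE (k : 'I_n) : nth 0 (sort >=%R t) k = d 0 (s k).
  by rewrite sE -tnth_nth !tnth_mktuple.
have := sorted_leq_nth ge_trans (fun x => lexx x) 0 srt.
move=> /(_ i j); rewrite !inE size_sort size_tuple !ltn_ord !ntE; exact.
Qed.

Lemma col_perm_orthonormal m q (P : 'M[R]_(m, q)) (s : 'S_q) :
  P^T *m P = 1%:M -> (col_perm s P)^T *m col_perm s P = 1%:M.
Proof.
move=> PP; apply/matrixP => i j; have /matrixP/(_ (s i) (s j)) := PP.
rewrite !mxE (inj_eq perm_inj) => <-.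
by apply: eq_bigr => k _; rewrite !mxE.
Qed.

Lemma col_perm_factor m n q (P : 'M[R]_(m, q)) (Q : 'M[R]_(n, q)) (d : 'rV_q) (s : 'S_q) :
  col_perm s P *m diag_mx (col_perm s d) *m (col_perm s Q)^T = P *m diag_mx d *m Q^T.
Proof.
apply/matrixP => i j; rewrite !mul_diag_trE [RHS](reindex_inj (@perm_inj _ s)).
by apply: eq_bigr => k _; rewrite !mxE.
Qed.

Lemma spectral_thm_sorted n (S : 'M[R]_n) : S^T = S ->
  exists (P : 'M_n) (d : 'rV_n),
  [/\ P^T *m P = 1%:M, forall i j : 'I_n, (i <= j)%N -> d 0 j <= d 0 i
    & S = P *m diag_mx d *m P^T].
Proof.
move=> /spectral_thm[P [d PP Sd]]; have [s ds] := exists_sorting_perm d.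
exists (col_perm s P), (col_perm s d); split; first exact: col_perm_orthonormal.
  by move=> i j ij; rewrite !mxE ds.
by rewrite col_perm_factor.
Qed.

(** Sylvester's identity: the determinant of the single block matrix [['X, A], [B, 1]] is computed
    by two block eliminations. The powers of 'X on both sides avoid comparing n with p. *)
Lemma char_poly_mulmxC n p (A : 'M[R]_(n, p)) (B : 'M[R]_(p, n)) :
  'X^p * char_poly (A *m B) = 'X^n * char_poly (B *m A).
Proof.
rewrite /char_poly /char_poly_mx !map_mxM.
set a := map_mx _ A; set b := map_mx _ B.
pose M : 'M[{poly R}]_(n + p) := block_mx 'X%:M a b 1%:M.
have detM : \det M = \det ('X%:M - a *m b).
  have : M *m block_mx 1%:M 0 (- b) 1%:M = block_mx ('X%:M - a *m b) a 0 1%:M.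
    rewrite mulmx_block !mulmx1 !mul1mx !mulmx0 !add0r mulmxN.
    by rewrite subrr.
  move/(congr1 determinant); rewrite det_mulmx det_lblock det_ublock !det1 !mulr1.
  exact.
have : block_mx 1%:M 0 (- b) 'X%:M *m M = block_mx 'X%:M a 0 ('X%:M - b *m a).
  rewrite mulmx_block !mul0mx !mul1mx !mulmx1 !addr0 !mulNmx.
  by rewrite mul_mx_scalar mul_scalar_mx addNr addrC.
move/(congr1 determinant); rewrite det_mulmx det_lblock det_ublock det1 mul1r detM.
by rewrite !det_scalar.
Qed.

Lemma is_sing_vals_factor n1 n2 (X : 'M[R]_(n1, n2)) (d : 'rV_(minn n1 n2)) P Q :
  P^T *m P = 1%:M -> Q^T *m Q = 1%:M -> (forall i, 0 <= d 0 i) ->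
  (forall i j : 'I_(minn n1 n2), (i <= j)%N -> d 0 j <= d 0 i) ->
  X = P *m diag_mx d *m Q^T -> is_sing_vals X (d 0).
Proof.
move=> PP QQ d_ge0 d_mono Xd; split=> //; split=> //.
have -> : X^T *m X = Q *m (diag_mx d *m diag_mx d *m Q^T).
  by rewrite Xd !trmx_mul trmxK tr_diag_mx !mulmxA -(mulmxA _ P^T) PP mulmx1.
(* Moving Q to the other side of the product leaves the characteristic polynomial of the squared
   diagonal matrix; the extra power of 'X is then cancelled. *)
have Xq_neq0 : ('X^(minn n1 n2) : {poly R}) != 0 by rewrite -size_poly_eq0 size_polyXn.
apply: (mulfI Xq_neq0); rewrite char_poly_mulmxC -(mulmxA _ Q^T) QQ mulmx1 mulrA -exprD.
rewrite subnKC ?geq_minr //; congr (_ * _).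
rewrite mulmx_diag char_poly_trig ?diag_mx_is_trig //.
by apply: eq_bigr => i _; rewrite !mxE eqxx mulr1n expr2.
Qed.

(** The characteristic polynomial determines the multiset of squares, monotonicity their order, and
    nonnegativity the square roots. *)
Lemma is_sing_vals_unique n1 n2 (X : 'M[R]_(n1, n2)) s t :
  is_sing_vals X s -> is_sing_vals X t -> s =1 t.
Proof.
move=> [s_ge0 [s_mono sE]] [t_ge0 [t_mono tE]].
have Xk_neq0 : ('X^(n2 - minn n1 n2) : {poly R}) != 0 by rewrite -size_poly_eq0 size_polyXn.
move: sE; rewrite tE => /(mulfI Xk_neq0).
pose l (f : 'I_(minn n1 n2) -> R) := [seq f i ^+ 2 | i <- enum 'I_(minn n1 n2)].
have lE f : \prod_(i < minn n1 n2) ('X - (f i ^+ 2)%:P) = \prod_(x <- l f) ('X - x%:P).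
  by rewrite big_map big_enum.
rewrite !lE => /prod_XsubC_eq lst.
have srt f : (forall i, 0 <= f i) ->
    (forall i j : 'I_(minn n1 n2), (i <= j)%N -> f j <= f i) -> sorted >=%R (l f).
  move=> f_ge0 f_mono; rewrite /l.
  apply: (homo_sorted (e := relpre val leq)) => [i j /= ij|].
    by rewrite ler_sqr ?nnegrE ?f_mono.
  by rewrite -sorted_map val_enum_ord iota_sorted.
have ge_trans : transitive (>=%R : rel R) by move=> y x z /= yx zy; apply: le_trans yx.
have ge_anti : antisymmetric (>=%R : rel R) by move=> x y; rewrite andbC => /le_anti.
have ll : l t = l s by apply: (sorted_eq ge_trans ge_anti) => //; apply: srt.
move=> i; have /eq_in_map/(_ i (mem_enum _ _)) := ll.
by move/eqP; rewrite eqrXn2 // => /eqP.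
Qed.

Lemma svd_sorted n1 n2 (X : 'M[R]_(n1, n2)) :
  exists P Q (d : 'rV_(minn n1 n2)),
  [/\ P^T *m P = 1%:M, Q^T *m Q = 1%:M, forall i, 0 <= d 0 i,
    forall i j : 'I_(minn n1 n2), (i <= j)%N -> d 0 j <= d 0 i
    & X = P *m diag_mx d *m Q^T].
Proof.
have [P [Q [d [PP QQ d_ge0 Xd]]]] := svd_unsorted X erefl.
have [s ds] := exists_sorting_perm d.
exists (col_perm s P), (col_perm s Q), (col_perm s d).
split; rewrite ?col_perm_factor //; try exact: col_perm_orthonormal.
  by move=> i; rewrite mxE.
by move=> i j ij; rewrite !mxE ds.
Qed.

Lemma sing_valsP n1 n2 (X : 'M[R]_(n1, n2)) : is_sing_vals X (sing_vals X).
Proof.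
apply: epsilon_spec; have [P [Q [d [PP QQ d_ge0 d_mono Xd]]]] := svd_sorted X.
by exists (d 0); apply: is_sing_vals_factor Xd.
Qed.

Lemma sigma_ord n1 n2 (X : 'M[R]_(n1, n2)) (i : 'I_(minn n1 n2)) : sigma X i = sing_vals X i.
Proof.
rewrite /sigma; case: ltnP => [Hi|]; last by rewrite leqNgt ltn_ord.
by congr sing_vals; apply/val_inj.
Qed.

Lemma sigma_out n1 n2 (X : 'M[R]_(n1, n2)) i : (minn n1 n2 <= i)%N -> sigma X i = 0.
Proof. by rewrite /sigma; case: ltnP. Qed.

Lemma sigma_ge0 n1 n2 (X : 'M[R]_(n1, n2)) i : 0 <= sigma X i.
Proof.
have [iq|/sigma_out-> //] := ltnP i (minn n1 n2).
by rewrite (sigma_ord X (Ordinal iq)); have [] := sing_valsP X.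
Qed.

Lemma sigma_mono n1 n2 (X : 'M[R]_(n1, n2)) i j : (i <= j)%N -> sigma X j <= sigma X i.
Proof.
move=> ij; have [jq|/sigma_out-> //] := ltnP j (minn n1 n2); last exact: sigma_ge0.
have iq := leq_ltn_trans ij jq.
rewrite (sigma_ord X (Ordinal iq)) (sigma_ord X (Ordinal jq)).
by have [_ [sm _]] := sing_valsP X; apply: sm.
Qed.

Definition sigma_row n1 n2 (X : 'M[R]_(n1, n2)) : 'rV[R]_(minn n1 n2) := \row_i sigma X i.

(** By uniqueness, the values picked by [epsilon] can be read off any sorted nonnegative
    factorization. *)
Lemma sigma_of_factor n1 n2 (X : 'M[R]_(n1, n2)) (d : 'rV_(minn n1 n2)) P Q :
  P^T *m P = 1%:M -> Q^T *m Q = 1%:M -> (forall i, 0 <= d 0 i) ->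
  (forall i j : 'I_(minn n1 n2), (i <= j)%N -> d 0 j <= d 0 i) ->
  X = P *m diag_mx d *m Q^T -> forall i : 'I_(minn n1 n2), sigma X i = d 0 i.
Proof.
move=> PP QQ d_ge0 d_mono Xd i; rewrite sigma_ord.
by apply: is_sing_vals_unique (sing_valsP X) _ i; apply: is_sing_vals_factor Xd.
Qed.

Lemma svd n1 n2 (X : 'M[R]_(n1, n2)) :
  exists P Q, [/\ P^T *m P = 1%:M, Q^T *m Q = 1%:M
    & X = P *m diag_mx (sigma_row X) *m Q^T].
Proof.
have [P [Q [d [PP QQ d_ge0 d_mono Xd]]]] := svd_sorted X.
exists P, Q; split=> //; rewrite {1}Xd; congr (_ *m diag_mx _ *m _).
by apply/rowP => i; rewrite mxE; symmetry; apply: sigma_of_factor Xd i.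
Qed.

End SingularValues.

(** * Mirsky's inequality *)

Section Mirsky.
Variable R : rcfType.

Lemma dot_diag n (x y d : 'rV[R]_n) : dot (x *m diag_mx d) y = \sum_k d 0 k * (x 0 k * y 0 k).
Proof.
rewrite dotE big_ord1; apply: eq_bigr => k _.
by rewrite mul_mx_diag mxE mulrAC mulrC.
Qed.

Lemma dot_row n (x y : 'rV[R]_n) : dot x y = \sum_k x 0 k * y 0 k.
Proof. by rewrite dotE big_ord1. Qed.

Lemma dot_diag_ge n (x d : 'rV[R]_n) a : (forall k, x 0 k != 0 -> a <= d 0 k) ->
  a * dot x x <= dot (x *m diag_mx d) x.
Proof.
move=> ad; rewrite dot_diag dot_row mulr_sumr; apply: ler_sum => k _.
have [->|xk] := eqVneq (x 0 k) 0; first by rewrite !mul0r !mulr0.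
by rewrite ler_wpM2r ?ad // -expr2 sqr_ge0.
Qed.

Lemma dot_diag_le n (x d : 'rV[R]_n) a : (forall k, x 0 k != 0 -> d 0 k <= a) ->
  dot (x *m diag_mx d) x <= a * dot x x.
Proof.
move=> da; rewrite dot_diag dot_row mulr_sumr; apply: ler_sum => k _.
have [->|xk] := eqVneq (x 0 k) 0; first by rewrite !mul0r !mulr0.
by rewrite ler_wpM2r ?da // -expr2 sqr_ge0.
Qed.

Lemma dot_diag_ge0 n (x d : 'rV[R]_n) : (forall k, 0 <= d 0 k) -> 0 <= dot (x *m diag_mx d) x.
Proof. by move=> d_ge0; rewrite -(mul0r (dot x x)); apply: dot_diag_ge. Qed.

(** The residual x - x P P^T of the orthogonal projection has nonnegative squared norm. *)
Lemma bessel m n q (P : 'M[R]_(n, q)) (x : 'M_(m, n)) : P^T *m P = 1%:M ->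
  dot (x *m P) (x *m P) <= dot x x.
Proof.
move=> PP; have := dot_ge0 (x - x *m P *m P^T).
have h : dot (x *m P *m P^T) (x *m P *m P^T) = dot (x *m P) (x *m P).
  by rewrite dot_mulr trmxK -(mulmxA _ P^T) PP mulmx1.
rewrite dotDl !dotDr !dotNl !dotNr h (dotC x) dot_mulr trmxK; lra.
Qed.

Lemma dot_isometry m n q (P : 'M[R]_(n, q)) (x y : 'M_(m, q)) : P^T *m P = 1%:M ->
  dot (x *m P^T) (y *m P^T) = dot x y.
Proof. by move=> PP; rewrite dot_mulr trmxK -mulmxA PP mulmx1. Qed.

Lemma pid_mulr_lt m n k (x : 'M[R]_(m, n)) i (j : 'I_n) :
  (j < k)%N -> x *m (pid_mx k : 'M_(n, k)) = 0 -> x i j = 0.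
Proof.
move=> jk /matrixP/(_ i (Ordinal jk)); rewrite !mxE (bigD1 j) //= big1 ?addr0 => [|l lj].
  by rewrite mxE eqxx jk mulr1.
by rewrite mxE /= -[_ == _ :> nat]/(l == j) (negbTE lj) mulr0.
Qed.

Lemma pid_mul_ge m n k (x : 'M[R]_(m, k)) i (j : 'I_n) :
  (k <= j)%N -> (x *m pid_mx k) i j = 0.
Proof.
move=> kj; rewrite mxE big1 // => l _; rewrite mxE.
by rewrite (ltn_eqF (leq_trans (ltn_ord l) kj)) mulr0.
Qed.

(* M meets the span of the eigenvectors of index >= i nontrivially. *)
Lemma eigenvalue_ge n p (P C : 'M[R]_n) (c : 'rV_n) (M : 'M_(p, n)) a (i : 'I_n) :
  P^T *m P = 1%:M -> (forall i j : 'I_n, (i <= j)%N -> c 0 j <= c 0 i) ->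
  C = P *m diag_mx c *m P^T -> (i < \rank M)%N ->
  (forall x : 'rV_n, (x <= M)%MS -> a * dot x x <= dot (x *m C) x) -> a <= c 0 i.
Proof.
move=> PP c_mono CE iM aC; pose K := P *m (pid_mx i : 'M_(n, i)).
have PP' : P *m P^T = 1%:M by apply: mulmx1C.
have cap_neq0 : (M :&: kermx K)%MS != 0.
  rewrite -mxrank_eq0 -lt0n.
  have := mxrank_sum_cap M (kermx K); have := rank_leq_col (M + kermx K)%MS.
  by rewrite mxrank_ker; have := rank_leq_col K; have := ltn_ord i; lia.
have /rowV0Pn[x /[!sub_capmx]/andP[xM /sub_kermxP xK] x_neq0] := cap_neq0.
pose y := x *m P.
have yx : dot y y = dot x x by rewrite dot_mulr -mulmxA PP' mulmx1.
have xC : dot (x *m C) x = dot (y *m diag_mx c) y.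
  by rewrite CE !mulmxA dot_mulr trmxK.
have : a * dot x x <= c 0 i * dot x x.
  apply: le_trans (aC x xM) _; rewrite xC -yx; apply: dot_diag_le => k yk.
  apply: c_mono; rewrite leqNgt; apply: contra yk => ki.
  by apply/eqP; apply: (pid_mulr_lt _ ki); rewrite -mulmxA.
by rewrite ler_pM2r // dot_gt0.
Qed.

(** * Weyl-type comparison of singular values with the eigenvalues of a matrix dominating the
    dilation *)

Section Dilation.
Variables (n1 n2 : nat) (X : 'M[R]_(n1, n2)) (P C : 'M[R]_(n1 + n2)) (c : 'rV[R]_(n1 + n2)).
Hypothesis PP : P^T *m P = 1%:M.
Hypothesis c_mono : forall i j : 'I_(n1 + n2), (i <= j)%N -> c 0 j <= c 0 i.
Hypothesis CE : C = P *m diag_mx c *m P^T.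
(* C dominates the symmetric dilation [[0, X], [X^T, 0]] of X, whose spectrum is
   {sigma_i, - sigma_i} completed by zeros. *)
Hypothesis XC : forall (x1 : 'rV_n1) (x2 : 'rV_n2),
  2 * dot (x1 *m X) x2 <= dot (row_mx x1 x2 *m C) (row_mx x1 x2).

(** The test space consists of the rows (e U^T, e V^T) with e supported on the first i + 1
    coordinates; there the dilation has Rayleigh quotient at least sigma_i. *)
Lemma dilation_top (i : 'I_(n1 + n2)) : (i < minn n1 n2)%N -> sigma X i <= c 0 i.
Proof.
move=> iq; have [U [V [UU VV XE]]] := svd X.
pose M := (pid_mx i.+1 : 'M_(i.+1, minn n1 n2)) *m row_mx U^T V^T.
apply: (eigenvalue_ge (M := M)) CE _ _ => //.
  (* Multiplication by [col_mx U V] returns twice a partial identity of rank i + 1, so the test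
     space has full dimension. *)
  have : (\rank (M *m col_mx U V) <= \rank M)%N by apply: mxrankM_maxl.
  rewrite -mulmxA mul_row_col UU VV -raddfD mul_mx_scalar mxrank_scale_nz ?rank_pid_mx //.
  by rewrite -[1 + 1]/(2%:R) pnatr_eq0.
move=> x /submxP[b xE]; pose e := b *m (pid_mx i.+1 : 'M_(i.+1, minn n1 n2)).
have {xE} -> : x = row_mx (e *m U^T) (e *m V^T) by rewrite xE mulmxA mul_mx_row.
apply: le_trans (XC _ _); rewrite dot_row_mx !dot_isometry //.
rewrite {2}XE !mulmxA -(mulmxA e) UU mulmx1 dot_isometry //.
have : sigma X i * dot e e <= dot (e *m diag_mx (sigma_row X)) e; last by lra.
apply: dot_diag_ge => k ek; rewrite mxE; apply: sigma_mono; rewrite -ltnS ltnNge.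
by apply: contra ek => ik; rewrite pid_mul_ge.
Qed.

(** The test space is cut out by k linear conditions: x1 U - x2 V vanishes on the first k
    coordinates. Its codimension is at most k. *)
Lemma dilation_bottom k (i : 'I_(n1 + n2)) : (k <= minn n1 n2)%N -> (i + k < n1 + n2)%N ->
  - sigma X k <= c 0 i.
Proof.
move=> kq ik; have [U [V [UU VV XE]]] := svd X.
pose K := col_mx U (- V) *m (pid_mx k : 'M_(minn n1 n2, k)).
apply: (eigenvalue_ge (M := kermx K)) CE _ _ => //.
  by rewrite mxrank_ker; have := rank_leq_col K; lia.
move=> x /sub_kermxP xK; rewrite -[x]hsubmxK in xK *.
move: (lsubmx x) (rsubmx x) xK => x1 x2 xK.
apply: le_trans (XC _ _); rewrite dot_row_mx {2}XE !mulmxA dot_mulr trmxK.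
have := bessel x1 UU; have := bessel x2 VV.
set e := x1 *m U; set f := x2 *m V => be bf.
set D := diag_mx _; pose g := e - f.
have gk (j : 'I__) : (j < k)%N -> g 0 j = 0.
  move=> jk; apply: (pid_mulr_lt _ jk); move: xK.
  by rewrite /K mulmxA mul_row_col mulmxN.
have gD : dot (g *m D) g <= sigma X k * dot g g.
  apply: dot_diag_le => j gj; rewrite mxE; apply: sigma_mono.
  by rewrite leqNgt; apply: contra gj => /gk->.
have hD : 0 <= dot ((e + f) *m D) (e + f).
  by apply: dot_diag_ge0 => j; rewrite mxE sigma_ge0.
have efD : dot (f *m D) e = dot (e *m D) f by rewrite dot_mulr tr_diag_mx dotC.
have hg : 0 <= dot (e + f) (e + f) by apply: dot_ge0.
have : sigma X k * dot g g <= sigma X k * (2 * (dot e e + dot f f)).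
  apply: ler_wpM2l; first exact: sigma_ge0.
  by move: hg; rewrite /g !(dotDl, dotDr, dotNl, dotNr, dotC f e); lra.
have : sigma X k * (dot e e + dot f f) <= sigma X k * (dot x1 x1 + dot x2 x2).
  by apply: ler_wpM2l; [exact: sigma_ge0 | lra].
move: hD gD; rewrite /g !(mulmxDl, mulNmx, dotDl, dotDr, dotNl, dotNr) efD; lra.
Qed.

End Dilation.

Lemma trace_thin n q (P : 'M[R]_(n, q)) (c : 'rV_q) : P^T *m P = 1%:M ->
  \tr (P *m diag_mx c *m P^T) = \sum_i c 0 i.
Proof. by move=> PP; rewrite mxtrace_mulC mulmxA PP mul1mx mxtrace_diag. Qed.

Lemma mirsky n1 n2 (X Y : 'M[R]_(n1, n2)) :
  \sum_(i < minn n1 n2) `|sigma X i - sigma Y i| <= nucnorm (X - Y).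
Proof.
set Z := X - Y; have [U [V [UU VV ZE]]] := svd Z.
pose D := diag_mx (sigma_row Z).
(* The absolute value of dil Z is block diagonal with blocks U D U^T and V D V^T; its average with
   dil Z is the positive part, to which dil Y is added. *)
pose C : 'M_(n1 + n2) := block_mx (2^-1 *: (U *m D *m U^T)) (Y + 2^-1 *: Z)
   (Y + 2^-1 *: Z)^T (2^-1 *: (V *m D *m V^T)).
have C_form (x1 : 'rV_n1) (x2 : 'rV_n2) : dot (row_mx x1 x2 *m C) (row_mx x1 x2) =
    2^-1 * dot (x1 *m U *m D) (x1 *m U) + 2^-1 * dot (x2 *m V *m D) (x2 *m V)
    + 2 * dot (x1 *m Y) x2 + dot (x1 *m Z) x2.
  rewrite mul_row_block dot_row_mx !dotDl -!scalemxAr !dotZl !mulmxA.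
  rewrite (dot_mulr _ U^T) (dot_mulr _ V^T) (dot_mulr _ (Y + _)^T) !trmxK.
  rewrite (dotC x2).
  by rewrite mulmxDr dotDl -scalemxAr dotZl; field.
have ZD (x1 : 'rV_n1) (x2 : 'rV_n2) : dot (x1 *m Z) x2 = dot (x1 *m U *m D) (x2 *m V).
  by rewrite [in LHS]ZE !mulmxA dot_mulr trmxK.
have D_ge0 (e : 'rV_(minn n1 n2)) : 0 <= dot (e *m D) e.
  by apply: dot_diag_ge0 => k; rewrite mxE sigma_ge0.
have D_sym (e f : 'rV_(minn n1 n2)) : dot (f *m D) e = dot (e *m D) f.
  by rewrite dot_mulr tr_diag_mx dotC.
(* The gap between C and dil Y is half the form of D at x1 U + x2 V; for dil X below, it is half the
   form at x1 U - x2 V. *)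
have YC (x1 : 'rV_n1) (x2 : 'rV_n2) :
    2 * dot (x1 *m Y) x2 <= dot (row_mx x1 x2 *m C) (row_mx x1 x2).
  have := D_ge0 (x1 *m U + x2 *m V).
  by rewrite C_form ZD mulmxDl !(dotDl, dotDr) (D_sym (x1 *m U)); lra.
have XC (x1 : 'rV_n1) (x2 : 'rV_n2) :
    2 * dot (x1 *m X) x2 <= dot (row_mx x1 x2 *m C) (row_mx x1 x2).
  have := D_ge0 (x1 *m U - x2 *m V).
  have -> : X = Y + Z by rewrite addrC subrK.
  rewrite C_form mulmxDr dotDl ZD mulmxDl mulNmx !(dotDl, dotDr, dotNl, dotNr).
  by rewrite (D_sym (x1 *m U)); lra.
have trC : \tr C = nucnorm Z.
  rewrite mxtrace_block !mxtraceZ !trace_thin // -mulrDl.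
  have -> : 2^-1 + 2^-1 = 1 :> R by lra.
  by rewrite mul1r; apply: eq_bigr => i _; rewrite mxE.
have symC : C^T = C.
  by rewrite tr_block_mx trmxK !linearZ /= !trmx_mul !trmxK !tr_diag_mx !mulmxA.
have [W [c [WW c_mono CE]]] := spectral_thm_sorted symC.
have top T := dilation_top (X := T) WW c_mono CE.
have bot T := dilation_bottom (X := T) WW c_mono CE.
rewrite -trC CE trace_thin //.
(* Eigenvalues indexed by natural numbers, with default 0, let the trace be cut into its first q
   terms, a middle part and its last q terms. *)
pose cn k := if insub k is Some i then c 0 i else 0 : R.
have cnE (i : 'I_(n1 + n2)) : cn i = c 0 i by rewrite /cn valK.
have cn_top k : (k < minn n1 n2)%N -> sigma X k <= cn k /\ sigma Y k <= cn k.
  move=> kq; have kN : (k < n1 + n2)%N by lia.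
  by rewrite (cnE (Ordinal kN)); split;
    [exact: (top X XC (Ordinal kN)) | exact: (top Y YC (Ordinal kN))].
have cn_bot k j : (k <= minn n1 n2)%N -> (j + k < n1 + n2)%N ->
    - sigma X k <= cn j /\ - sigma Y k <= cn j.
  move=> kq jk; have jN : (j < n1 + n2)%N by lia.
  by rewrite (cnE (Ordinal jN)); split;
    [exact: (bot X XC k (Ordinal jN)) | exact: (bot Y YC k (Ordinal jN))].
under [X in _ <= X]eq_bigr do rewrite -cnE.
rewrite -(big_mkord xpredT cn) -(big_mkord xpredT (fun i => `|sigma X i - sigma Y i|)).
set q := minn n1 n2 in cn_top cn_bot *.
have qN : (q + q <= n1 + n2)%N by rewrite /q; lia.
rewrite [X in _ <= X](@big_cat_nat _ _ _ q) //=; last by lia.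
rewrite [X in _ <= _ + X](@big_cat_nat _ _ _ (n1 + n2 - q)%N) //=; [|by lia|by lia].
(* Reversing the last block pairs the i-th largest eigenvalue with the i-th smallest. *)
have -> : \sum_(n1 + n2 - q <= i < n1 + n2) cn i = \sum_(0 <= i < q) cn (n1 + n2 - i.+1)%N.
  rewrite -{1}[(n1 + n2 - q)%N]add0n big_addn subKn; last by lia.
  rewrite big_nat_rev; apply: eq_big_nat => i iq; congr cn; lia.
(* The lower bound with k = q applies here, where sigma_q = 0 by convention. *)
have mid : 0 <= \sum_(q <= i < n1 + n2 - q) cn i.
  rewrite big_nat sumr_ge0 // => i /andP[qi iN].
  by have [] := cn_bot q i (leqnn _); rewrite ?sigma_out ?oppr0 //; lia.
rewrite addrCA -[X in X <= _]add0r lerD // -big_split /=.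
rewrite !big_nat; apply: ler_sum => i /andP[_ iq].
(* The upper eigenvalue dominates both sigma_i(X) and sigma_i(Y), the lower one both of their
   negatives, so the pair sums to at least the absolute difference. *)
have [t1 t2] := cn_top i iq; have [] := cn_bot i (n1 + n2 - i.+1)%N (ltnW iq).
  by lia.
by move=> b1 b2; rewrite ler_norml; apply/andP; split; lra.
Qed.

End Mirsky.

(** * Trace inequalities and the null space condition *)

Section Recovery.
Variable R : rcfType.

Lemma frob2E n1 n2 (X : 'M[R]_(n1, n2)) : frob2 X = dot X X.
Proof. by rewrite dotE. Qed.

Lemma opAD m n1 n2 (A : 'I_m -> 'M[R]_(n1, n2)) X Y : opA A (X + Y) = opA A X + opA A Y.
Proof. by apply/colP => i; rewrite !mxE mulmxDr mxtraceD. Qed.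

Lemma opAZ m n1 n2 (A : 'I_m -> 'M[R]_(n1, n2)) a X : opA A (a *: X) = a *: opA A X.
Proof. by apply/colP => i; rewrite !mxE -scalemxAr mxtraceZ. Qed.

(** When r exceeds the number of singular values, the surplus terms are zero. *)
Lemma sum_sigma_head n1 n2 (H : 'M[R]_(n1, n2)) r :
  \sum_(0 <= i < r) sigma H i = \sum_(i < minn n1 n2 | (i < r)%N) sigma H i.
Proof.
set q := minn n1 n2; rewrite -(big_mkord (fun i => (i < r)%N) (sigma H)).
have [rq|qr] := leqP r q.
  rewrite (@big_cat_nat _ _ _ r 0 q) //= [X in _ + X]big_nat_cond [X in _ + X]big1 ?addr0.
    by rewrite [RHS]big_nat_cond [LHS]big_nat; apply: eq_bigl => i; rewrite /= andbb.
  by move=> i /andP[/andP[ri _]]; rewrite ltnNge ri.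
rewrite (@big_cat_nat _ _ _ q 0 r) //= 1?ltnW // [X in _ + X]big_nat [X in _ + X]big1 ?addr0.
  rewrite [RHS]big_nat_cond [LHS]big_nat; apply: eq_bigl => i /=.
  by case: (ltnP i q) => //= iq; rewrite (ltn_trans iq).
by move=> i /andP[qi _]; apply: sigma_out.
Qed.

Lemma sum_sigma_tail n1 n2 (H : 'M[R]_(n1, n2)) r :
  \sum_(r <= i < minn n1 n2) sigma H i = \sum_(i < minn n1 n2 | ~~ (i < r)%N) sigma H i.
Proof.
rewrite -(big_mkord (fun i => ~~ (i < r)%N) (sigma H)) (big_nat_widenl _ 0) //=.
by apply: eq_bigl => i; rewrite -leqNgt.
Qed.

(** Bessel's inequality for a unit column of P against the orthonormal columns of U. *)
Lemma row_sq_le1 m q (P U : 'M[R]_(m, q)) : P^T *m P = 1%:M -> U^T *m U = 1%:M ->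
  forall k, \sum_i (P^T *m U) k i ^+ 2 <= 1.
Proof.
move=> PP UU k; pose x := row k P^T.
have xE : dot x x = 1.
  have /matrixP/(_ k k) := PP; rewrite !mxE eqxx dotE big_ord1 [true%:R]mulr1n => <-.
  by apply: eq_bigr => j _; rewrite !mxE.
have xU i : (x *m U) 0 i = (P^T *m U) k i by rewrite -row_mul [LHS]mxE.
have := bessel x UU; rewrite xE dot_row; under eq_bigr do rewrite xU -expr2.
exact.
Qed.

Lemma col_sq_le1 m q (P U : 'M[R]_(m, q)) : P^T *m P = 1%:M -> U^T *m U = 1%:M ->
  forall i, \sum_k (P^T *m U) k i ^+ 2 <= 1.
Proof.
move=> PP UU i; have := row_sq_le1 UU PP i.
have PU k : (U^T *m P) i k = (P^T *m U) k i by rewrite -[P in LHS]trmxK -trmx_mul [LHS]mxE.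
under eq_bigr do rewrite PU; exact.
Qed.

(* AM-GM on each product G_ki F_ki makes (G_ki^2 + F_ki^2) / 2 a doubly substochastic weight. *)
Lemma dot_factor_le n1 n2 q (P U : 'M[R]_(n1, q)) (Q V : 'M[R]_(n2, q)) :
  P^T *m P = 1%:M -> Q^T *m Q = 1%:M -> U^T *m U = 1%:M -> V^T *m V = 1%:M ->
  exists w : 'M[R]_q, [/\ forall k i, 0 <= w k i,
    forall k, \sum_i w k i <= 1, forall i, \sum_k w k i <= 1
    & forall e d : 'rV_q, dot (P *m diag_mx e *m Q^T) (U *m diag_mx d *m V^T) <=
        \sum_k \sum_i `|e 0 k| * (`|d 0 i| * w k i)].
Proof.
move=> PP QQ UU VV; pose G := P^T *m U; pose F := Q^T *m V.
exists (\matrix_(k, i) ((G k i ^+ 2 + F k i ^+ 2) / 2)); split.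
- by move=> k i; rewrite mxE divr_ge0 // addr_ge0 // sqr_ge0.
- move=> k; under eq_bigr do rewrite mxE.
  rewrite -mulr_suml big_split /=.
  by have := row_sq_le1 PP UU k; have := row_sq_le1 QQ VV k; rewrite -/G -/F; lra.
- move=> i; under eq_bigr do rewrite mxE.
  rewrite -mulr_suml big_split /=.
  by have := col_sq_le1 PP UU i; have := col_sq_le1 QQ VV i; rewrite -/G -/F; lra.
move=> e d.
have -> : dot (P *m diag_mx e *m Q^T) (U *m diag_mx d *m V^T) =
    \tr (diag_mx e *m (F *m diag_mx d *m G^T)).
  by rewrite dot_mulr dot_mull trmxK /dot /F /G !trmx_mul !trmxK tr_diag_mx !mulmxA.
apply: ler_sum => k _; rewrite mul_diag_mx mxE mul_diag_trE mulr_sumr.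
apply: ler_sum => i _; rewrite [(\matrix_(_, _) _) k i]mxE; apply: le_trans (ler_norm _) _.
rewrite !normrM; apply: ler_wpM2l => //; rewrite -!mulrA; apply: ler_wpM2l => //.
have := sqr_ge0 (`|F k i| - `|G k i|).
rewrite -(real_normK (num_real (F k i))) -(real_normK (num_real (G k i))).
by rewrite sqrrB mulr2n; lra.
Qed.

(** The nuclear norm is the inner product with U V^T, and the column sums of the weights are at most
    1. Here [d] may be signed and unsorted, as for the perturbed matrix in the necessity proof. *)
Lemma nucnorm_factor_le n1 n2 (P : 'M[R]_(n1, minn n1 n2)) (Q : 'M[R]_(n2, minn n1 n2)) d :
  P^T *m P = 1%:M -> Q^T *m Q = 1%:M ->
  nucnorm (P *m diag_mx d *m Q^T) <= \sum_i `|d 0 i|.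
Proof.
move=> PP QQ; set Y := _ *m Q^T; have [U [V [UU VV YE]]] := svd Y.
have [w [w_ge0 _ w_col w_dot]] := dot_factor_le UU VV PP QQ.
have -> : nucnorm Y = dot (U *m diag_mx (const_mx 1) *m V^T) Y.
  rewrite {2}YE diag_const_mx mulmx1 !dot_isometry // dotC dot_mull UU.
  rewrite /dot trmx1 mulmx1 mxtrace_diag.
  by apply: eq_bigr => i _; rewrite mxE.
apply: le_trans (w_dot _ _) _; rewrite exchange_big /=; apply: ler_sum => i _.
under eq_bigr do rewrite mxE normr1 mul1r.
by rewrite -mulr_sumr -[leRHS]mulr1 ler_wpM2l.
Qed.

(** Only the first r singular values of X survive, each at most c; the substochastic weights then
    place at most the mass of r rows on the singular values of H, with at most 1 on each. *)
Lemma dot_le_sum_sigma n1 n2 (X H : 'M[R]_(n1, n2)) r (c : R) : 0 <= c ->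
  sigma X r = 0 -> specnorm X <= c ->
  dot X H <= c * \sum_(i < minn n1 n2 | (i < r)%N) sigma H i.
Proof.
move=> c_ge0 Xr Xc.
have [P [Q [PP QQ XE]]] := svd X; have [U [V [UU VV HE]]] := svd H.
have [w [w_ge0 w_row w_col w_dot]] := dot_factor_le PP QQ UU VV.
rewrite [in X in X <= _]XE [in X in X <= _]HE; apply: le_trans (w_dot _ _) _.
pose tau := sigma H r.
have nE (Z : 'M[R]_(n1, n2)) (k : 'I_(minn n1 n2)) : `|sigma_row Z 0 k| = sigma Z k.
  by rewrite mxE ger0_norm ?sigma_ge0.
have le1 : \sum_k \sum_i `|sigma_row X 0 k| * (`|sigma_row H 0 i| * w k i) <=
    \sum_(k < minn n1 n2 | (k < r)%N) c * (\sum_(i < minn n1 n2) sigma H i * w k i).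
  rewrite [leRHS]big_mkcond /=; apply: ler_sum => k _; rewrite -mulr_sumr nE.
  rewrite (eq_bigr (fun i : 'I__ => sigma H i * w k i)) => [|i _]; last by rewrite nE.
  case: ltnP => kr; last first.
    have -> : sigma X k = 0.
      by apply/eqP; rewrite eq_le sigma_ge0 -Xr sigma_mono.
    by rewrite mul0r.
  apply: ler_wpM2r; first by apply: sumr_ge0 => i _; rewrite mulr_ge0 ?sigma_ge0.
  by apply: le_trans Xc; apply: sigma_mono.
apply: le_trans le1 _; rewrite -mulr_sumr; apply: ler_wpM2l => //; rewrite exchange_big /=.
(* Threshold argument at [tau]: for 0 <= t <= 1, sigma_i t <= (sigma_i - tau) + tau t when sigma_i
   >= tau, and sigma_i t <= tau t otherwise. The total weight is then bounded through the row
   sums. *)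
apply: (@le_trans _ _ (\sum_(i < minn n1 n2) ((if (i < r)%N then sigma H i - tau else 0)
    + tau * \sum_(k < minn n1 n2 | (k < r)%N) w k i))).
  apply: ler_sum => i _; rewrite -mulr_sumr; set t := \sum_(k < minn n1 n2 | _) _.
  have t_ge0 : 0 <= t by apply: sumr_ge0.
  have t_le1 : t <= 1.
    apply: le_trans (w_col i); rewrite [leRHS](bigID (fun k : 'I__ => (k < r)%N)) /= lerDl.
    exact: sumr_ge0.
  case: ltnP => ir.
    by have : tau <= sigma H i by [exact: sigma_mono (ltnW ir)]; nra.
  by rewrite add0r ler_wpM2r // sigma_mono.
rewrite big_split /= -mulr_sumr -big_mkcond /= sumrB exchange_big /=.
rewrite -addrA gerDl addrC subr_le0.
have -> : \sum_(i < minn n1 n2 | (i < r)%N) tau = tau * \sum_(i < minn n1 n2 | (i < r)%N) 1.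
  by rewrite mulr_sumr; apply: eq_bigr => i _; rewrite mulr1.
apply: ler_wpM2l; first exact: sigma_ge0.
exact: ler_sum.
Qed.

(** If sigma_r were nonzero, so would be all r + 1 leading values; inverting them factors a matrix
    of rank r + 1 through X. *)
Lemma sigma_rank n1 n2 (X : 'M[R]_(n1, n2)) r : (\rank X <= r)%N -> sigma X r = 0.
Proof.
move=> Xr; have [rq|/sigma_out //] := ltnP r (minn n1 n2).
have [P [Q [PP QQ XE]]] := svd X.
apply/eqP; apply: contraTT Xr => sr; rewrite -ltnNge.
have s_neq0 k : (k <= r)%N -> sigma X k != 0.
  move=> kr; rewrite gt_eqF //; apply: lt_le_trans (sigma_mono X kr).
  by rewrite lt0r sr sigma_ge0.
pose D := diag_mx (sigma_row X); pose E := diag_mx (\row_(i < minn n1 n2) (sigma X i)^-1).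
pose M : 'M[R]_(r.+1, minn n1 n2) := pid_mx r.+1.
have DE : D = P^T *m X *m Q.
  by rewrite [in RHS]XE !mulmxA PP mul1mx -mulmxA QQ mulmx1.
have ME : M *m D *m E = M.
  rewrite -mulmxA mulmx_diag mul_mx_diag; apply/matrixP => i j; rewrite !mxE.
  have [/= ij|_] := eqVneq (i : nat) j; last by rewrite mul0r.
  by rewrite divff ?mulr1 // s_neq0 // -ij -ltnS.
have <- : \rank M = r.+1 by rewrite rank_pid_mx.
rewrite -ME; apply: leq_trans (mxrankM_maxl _ _) _; apply: leq_trans (mxrankM_maxr _ _) _.
by rewrite DE; apply: leq_trans (mxrankM_maxl _ _) _; apply: mxrankM_maxr.
Qed.

End Recovery.

(** * The null space condition implies unique recovery *)

Lemma null_space_sufficient (R : rcfType) (m n1 n2 : nat) (A : 'I_m -> 'M[R]_(n1, n2))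
  (r : nat) (alpha c : R) (X0 : 'M[R]_(n1, n2)) :
  0 < alpha -> 0 < c ->
  (forall H : 'M[R]_(n1, n2), opA A H = 0 ->
      (1 + c / alpha) * (\sum_(0 <= i < r) sigma H i)
        <= \sum_(r <= i < minn n1 n2) sigma H i) ->
  (\rank X0 <= r)%N -> specnorm X0 = c ->
  unique_minimizer_N2 A alpha (opA A X0) X0.
Proof.
move=> alpha_gt0 c_gt0 nullA X0r X0c; split=> // X AX X_neq.
have [H HE] : exists H, H = X0 - X by exists (X0 - X).
have XE : X = X0 - H by rewrite HE subKr.
have H_gt0 : 0 < dot H H.
  by rewrite dot_gt0 HE subr_eq0; apply/eqP => X0X; apply: X_neq.
have AH : opA A H = 0 by rewrite HE opAD -[- X]scaleN1r opAZ AX scaleN1r subrr.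
have := nullA H AH; rewrite sum_sigma_head sum_sigma_tail.
have X0r0 := sigma_rank X0r.
have := mirsky X0 H; rewrite -XE => mir.
have := @dot_le_sum_sigma _ _ _ X0 H r c (ltW c_gt0) X0r0.
rewrite X0c lexx => /(_ isT).
set S1 := \sum_(_ < _ | (_ < _)%N) _; set S2 := \sum_(_ < _ | _) _ => X0H S12.
have X0_tail (i : 'I_(minn n1 n2)) : ~~ (i < r)%N -> sigma X0 i = 0.
  by rewrite -leqNgt => ri; apply/eqP; rewrite eq_le sigma_ge0 andbT -X0r0 sigma_mono.
(* In Mirsky's sum the head terms are at least sigma_i(X0) - sigma_i(H), while the tail terms equal
   sigma_i(H) because X0 has no tail. *)
have nuc : nucnorm X0 - S1 + S2 <= nucnorm X.
  have -> : nucnorm X0 = \sum_(i < minn n1 n2 | (i < r)%N) sigma X0 i.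
    rewrite /nucnorm (bigID (fun i : 'I__ => (i < r)%N)) /=.
    by rewrite [X in _ + X]big1 ?addr0.
  apply: le_trans mir; rewrite [leRHS](bigID (fun i : 'I__ => (i < r)%N)) /= -sumrB.
  apply: lerD; apply: ler_sum => i ir; first exact: ler_norm.
  by rewrite X0_tail // sub0r normrN ler_norm.
rewrite /objN2 !frob2E.
have -> : dot X X = dot X0 X0 - 2 * dot X0 H + dot H H.
  by rewrite XE !(dotDl, dotDr, dotNl, dotNr) (dotC H X0); ring.
have k_gt0 : 0 < (2 * alpha)^-1 by rewrite invr_gt0 mulr_gt0.
(* The cross term costs at most (c / alpha) S1, exactly the excess granted by the null space
   condition. *)
have cE : c / alpha = c * (2 * (2 * alpha)^-1) by field; rewrite gt_eqF.
move: S12; rewrite cE; set k := (2 * alpha)^-1 in k_gt0 *.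
have : 0 < k * dot H H by rewrite mulr_gt0.
have : k * dot X0 H <= k * (c * S1) by rewrite ler_pM2l.
lra.
Qed.

(** * Unique recovery implies the null space condition *)

Lemma null_space_necessary (R : rcfType) (m n1 n2 : nat) (A : 'I_m -> 'M[R]_(n1, n2))
  (r : nat) (alpha c : R) (H : 'M[R]_(n1, n2)) :
  (1 <= r)%N -> 0 < alpha -> 0 < c ->
  (forall X0 : 'M[R]_(n1, n2), (\rank X0 <= r)%N -> specnorm X0 = c ->
      unique_minimizer_N2 A alpha (opA A X0) X0) ->
  opA A H = 0 ->
  (1 + c / alpha) * (\sum_(0 <= i < r) sigma H i)
    <= \sum_(r <= i < minn n1 n2) sigma H i.
Proof.
move=> r_gt0 alpha_gt0 c_gt0 recA AH; rewrite sum_sigma_head sum_sigma_tail.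
set S1 := \sum_(_ < _ | (_ < _)%N) _; set S2 := \sum_(_ < _ | _) _.
rewrite leNgt; apply/negP => S21.
have S2_ge0 : 0 <= S2 by apply: sumr_ge0 => i _; apply: sigma_ge0.
have c1_gt0 : 0 < 1 + c / alpha by rewrite addr_gt0 ?divr_gt0.
have S1_gt0 : 0 < S1 by rewrite -(pmulr_rgt0 _ c1_gt0); apply: le_lt_trans S21.
have q_gt0 : (0 < minn n1 n2)%N.
  rewrite lt0n; apply: contraTneq S1_gt0 => q0; rewrite /S1 big1 ?ltxx // => i _.
  by have := ltn_ord i; rewrite [X in (_ < X)%N]q0.
have [P [Q [PP QQ HE]]] := svd H.
pose e : 'rV[R]_(minn n1 n2) := \row_i (i < r)%N%:R.
pose X0 := P *m diag_mx (- c *: e) *m Q^T.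
have X0sigma (i : 'I_(minn n1 n2)) : sigma X0 i = c * (i < r)%N%:R.
  have -> : c * (i < r)%N%:R = (c *: e) 0 i by rewrite !mxE.
  (* The minus sign is absorbed into P, leaving a nonnegative sorted diagonal. *)
  apply: (@sigma_of_factor _ _ _ _ _ (- P) Q) => //.
  - by rewrite [(- P)^T]linearN /= mulNmx mulmxN opprK.
  - by move=> j; rewrite !mxE mulr_ge0 ?ler0n // ltW.
  - move=> j k jk; rewrite !mxE ler_pM2l // ler_nat.
    by case: ltnP => // kr; rewrite (leq_ltn_trans jk kr).
  - by rewrite /X0 scaleNr [diag_mx (- _)]linearN /= mulmxN !mulNmx.
have X0c : specnorm X0 = c.
  by rewrite /specnorm -[0%N]/(nat_of_ord (Ordinal q_gt0)) X0sigma /= r_gt0 mulr1.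
have X0r : (\rank X0 <= r)%N.
  have eE : diag_mx e = (pid_mx r : 'M_(_, r)) *m (pid_mx r : 'M_(r, _)).
    rewrite mul_pid_mx minnA !minnn; apply/matrixP => i j; rewrite !mxE.
    by rewrite -[(i : nat) == j]/(i == j); have [->|_] := eqVneq i j.
  have -> : X0 = (- c *: P *m (pid_mx r : 'M_(_, r))) *m ((pid_mx r : 'M_(r, _)) *m Q^T).
    by rewrite /X0 [diag_mx _]linearZ /= eE -scalemxAr -!scalemxAl !mulmxA.
  by apply: leq_trans (mxrankM_maxl _ _) _; apply: rank_leq_col.
have [_ X0min] := recA X0 X0r X0c.
have X0H : dot X0 H = - c * S1.
  rewrite {1}HE dot_isometry // dotC dot_mull mulmxA PP mul1mx.
  rewrite /dot tr_diag_mx mulmx_diag mxtrace_diag /S1 mulr_sumr [RHS]big_mkcond /=.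
  apply: eq_bigr => i _; rewrite !mxE; case: ltnP => _; by rewrite ?mulr1 ?mulr0 // mulrC.
have H_gt0 : 0 < dot H H.
  rewrite dot_gt0; apply: contraTneq S1_gt0 => H0; move/eqP: X0H.
  by rewrite H0 /dot trmx0 mulmx0 mxtrace0 eq_sym mulf_eq0 oppr_eq0 gt_eqF //= => /eqP->;
    rewrite ltxx.
have s0_gt0 : 0 < sigma H 0.
  rewrite lt0r sigma_ge0 andbT; apply: contraTneq S1_gt0 => s0; rewrite /S1 big1 ?ltxx // => i _.
  by apply/eqP; rewrite eq_le sigma_ge0 andbT -s0 sigma_mono.
pose g := (1 + c / alpha) * S1 - S2; have g_gt0 : 0 < g by rewrite subr_gt0.
(* The first bound keeps t sigma_i <= c, so each head entry shrinks in absolute value from c to c -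
   t sigma_i. The second keeps the quadratic term at most t g / 2, half of the first-order gain t
   g. *)
pose t := Num.min (c / sigma H 0) (alpha * g / dot H H).
have t_gt0 : 0 < t by rewrite lt_min !divr_gt0 // mulr_gt0.
have ts i : t * sigma H i <= c.
  apply: (@le_trans _ _ (t * sigma H 0)); first by rewrite ler_pM2l // sigma_mono.
  by rewrite -ler_pdivlMr // ge_min lexx.
have tH : t * dot H H <= alpha * g by rewrite -ler_pdivlMr // ge_min lexx orbT.
have Atr : opA A (X0 + t *: H) = opA A X0 by rewrite opAD opAZ AH scaler0 addr0.
have X_neq : X0 + t *: H <> X0.
  move/eqP; rewrite -subr_eq0 addrC addKr scaler_eq0 gt_eqF //=.
  by rewrite -dot_eq0 gt_eqF.
have := X0min _ Atr X_neq; rewrite /objN2 !frob2E.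
have nuc : nucnorm (X0 + t *: H) <= nucnorm X0 - t * S1 + t * S2.
  have -> : X0 + t *: H = P *m diag_mx (- c *: e + t *: sigma_row H) *m Q^T.
    rewrite linearD /= mulmxDr mulmxDl; congr (_ + _).
    by rewrite linearZ /= -scalemxAr -scalemxAl -HE.
  apply: le_trans (nucnorm_factor_le _ PP QQ) _.
  rewrite /nucnorm; under [X in _ <= X - _ + _]eq_bigr do rewrite X0sigma.
  rewrite /S1 /S2 !mulr_sumr [X in _ <= _ - X + _]big_mkcond [X in _ <= _ + X]big_mkcond /=.
  rewrite -sumrB -big_split /=.
  apply: ler_sum => i _; rewrite !mxE; case: ltnP => ir /=.
    by rewrite ler_norml; have := ts i => ?; apply/andP; split; lra.
  have : 0 <= t * sigma H i by rewrite mulr_ge0 ?sigma_ge0 // ltW.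
  by rewrite ler_norml => ?; apply/andP; split; lra.
have -> : dot (X0 + t *: H) (X0 + t *: H) = dot X0 X0 + 2 * t * dot X0 H + t * (t * dot H H).
  by rewrite !(dotDl, dotDr, dotZl, dotZr) (dotC H X0); ring.
have k_gt0 : 0 < (2 * alpha)^-1 by rewrite invr_gt0 mulr_gt0.
have cE : c / alpha = c * (2 * (2 * alpha)^-1) by field; rewrite gt_eqF.
have : (2 * alpha)^-1 * (t * (t * dot H H)) <= t * g / 2.
  have -> : t * g / 2 = (2 * alpha)^-1 * (t * (alpha * g)) by field; rewrite gt_eqF.
  by rewrite !ler_pM2l.
have : 0 < t * g by rewrite mulr_gt0.
rewrite X0H /g cE; move: (2 * alpha)^-1 => k; lra.
Qed.

Theorem mainTheorem8 (R : rcfType) (m n1 n2 : nat) (A : 'I_m -> 'M[R]_(n1, n2))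
  (r : nat) (alpha c : R) :
  (1 <= r)%N -> 0 < alpha -> 0 < c ->
  (forall X0 : 'M[R]_(n1, n2), (\rank X0 <= r)%N -> specnorm X0 = c ->
      unique_minimizer_N2 A alpha (opA A X0) X0)
  <->
  (forall H : 'M[R]_(n1, n2), opA A H = 0 ->
      (1 + c / alpha) * (\sum_(0 <= i < r) sigma H i)
        <= \sum_(r <= i < minn n1 n2) sigma H i).
Proof.
move=> r_gt0 alpha_gt0 c_gt0; split=> [recA H|nullA X0].
  exact: null_space_necessary.
exact: null_space_sufficient.
Qed.
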